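(* Let $n>1$ be an odd integer. Then for every integer $k\ge 0$ and every paravector $x\in C\ell(n)$, $$\tau_n\left[z^{k+n-1}\right](x)=P_k^n(x),$$ where the constant in the Fueter-Sce transformation $\tau_n$ of the complex monomial $z^{m}$, $m\ge n-1$, is chosen as $$\alpha_n\left[z^m\right]=(-1)^{\frac{n-1}{2}}\frac{(n-2)!!\,(m-n+1)!}{m!}.$$
   Context: **Clifford algebra.** $C\ell(n)$ is the real Clifford algebra generated by an orthonormal basis $\mathbf e_1,\dots,\mathbf e_n$ of $\mathbb R^n$ with $\mathbf e_i\mathbf e_j+\mathbf e_j\mathbf e_i=-2\delta_{ij}$. A point $(x_0,\dots,x_n)\in\mathbb R^{n+1}$ is identified with the paravector $x=x_0+\mathbf x$, where $\mathbf x=x_1\mathbf e_1+\dots+x_n\mathbf e_n$; its conjugate is $\overline x=x_0-\mathbf x$. A $C\ell(n)$-valued function on an open subset of $\mathbb R^{n+1}$ is $C\ell(n)$-holomorphic if it is annihilated by the generalized Cauchy-Riemann operator $\partial_{x_0}+\sum_{i=1}^n\mathbf e_i\partial_{x_i}$ (acting from the left). **Appell polynomials.** $P_k^n$ ($k\ge0$) is the $C\ell(n)$-holomorphic polynomial, homogeneous of degree $k$, of the form $$P^n_k(x)=\sum_{s=0}^k {}^nT^k_s\, x^{k-s}\,\overline{x}^{\,s},\qquad {}^nT^k_s\in\mathbb R,\qquad P^n_k(1)=1$$ (these conditions determine it uniquely). It is known that $$\sum_{s=0}^{k}(-1)^s\,{}^nT_s^k=c_n^k:=\begin{cases}\dfrac{(k-1)!!\,(n-2)!!}{(n+k-2)!!},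 & k \text{ even},\\[2mm] \dfrac{k!!\,(n-2)!!}{(n+k-1)!!}, & k\text{ odd},\end{cases}$$ with $(-1)!!=0!!=1$, so $P_k^n(\mathbf x)=c_n^k\mathbf x^k$ for vectors $\mathbf x$. **Fueter-Sce transformation.** Let $n>1$ be odd and let $f(w+\mathrm i y)=u(w,y)+\mathrm i v(w,y)$ be holomorphic, with $u,v$ real valued. Put $\boldsymbol\omega(\mathbf x)=\mathbf x/|\mathbf x|$. Then $$\tau_n[f](x)=\alpha_n[f]\left(\left(\frac1{|\mathbf x|}\partial_{|\mathbf x|}\right)^{\frac{n-1}2}u(x_0,|\mathbf x|)+\boldsymbol\omega(\mathbf x)\left(\partial_{|\mathbf x|}\frac1{|\mathbf x|}\right)^{\frac{n-1}2}v(x_0,|\mathbf x|)\right),$$ where $\alpha_n[f]$ is a real normalization constant, the operator $\partial_{|\mathbf x|}\frac{1}{|\mathbf x|}$ means ''multiply by $1/|\mathbf x|$, then differentiate with respect to $|\mathbf x|$'', and values at $\mathbf x=0$ are understood by continuous extension. *)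

(* Defs.v *)
From HB Require Import structures.
From mathcomp Require Import all_boot all_order all_algebra.
From mathcomp Require Import all_classical all_reals all_analysis.
From mathcomp Require Import complex ring.
Set Implicit Arguments.
Unset Strict Implicit.
Unset Printing Implicit Defensive.
Import Order.TTheory GRing.Theory Num.Theory.
Import numFieldNormedType.Exports.
Local Open Scope ring_scope.

(* The real Clifford algebra C\ell(n) with e_i e_j + e_j e_i = - 2 delta_ij:
   the real vector space with basis (e_A) indexed by the subsets A of
   {0, ..., n-1}, e_A being the increasing product of the e_i for i in A
   (blade_prod below).  The coordinates are stored in a row vector, whose
   norm topology is the topology used for limits and derivatives.  Indices
   are shifted: gen i is the basis vector usually numbered i + 1. *)
Definition clifford (R : realType) (n : nat) : Type :=
  'rV[R]_#|{: {set 'I_n}}|.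

#[warnings="-redundant-canonical-projection"]
HB.instance Definition _ (R : realType) (n : nat) :=
  NormedModule.copy (clifford R n) 'rV[R]_#|{: {set 'I_n}}|.
#[warnings="-redundant-canonical-projection"]
HB.instance Definition _ (R : realType) (n : nat) :=
  Complete.copy (clifford R n) 'rV[R]_#|{: {set 'I_n}}|.

Section CliffordProduct.
Variables (R : realType) (n : nat).
Local Notation Cl := (clifford R n).
Implicit Types (A B C : {set 'I_n}) (x y z : Cl).

Definition coef x A : R := (x : 'rV_ _) 0 (enum_rank A).

Definition clifford_of (f : {set 'I_n} -> R) : Cl := \row_j f (enum_val j).

Lemma coefE f A : coef (clifford_of f) A = f A.
Proof. by rewrite /coef mxE enum_rankK. Qed.

Lemma cliffordP x y : (forall A, coef x A = coef y A) -> x = y.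
Proof.
move=> xy; apply/rowP => j; have := xy (enum_val j).
by rewrite /coef enum_valK.
Qed.

Lemma coefD x y A : coef (x + y) A = coef x A + coef y A.
Proof. by rewrite /coef mxE. Qed.

Lemma coefZ (a : R) x A : coef (a *: x) A = a * coef x A.
Proof. by rewrite /coef mxE. Qed.

Lemma coef0 A : coef 0 A = 0.
Proof. by rewrite /coef mxE. Qed.

Lemma coef_sum (I : Type) (r : seq I) (P : pred I) (F : I -> Cl) A :
  coef (\sum_(i <- r | P i) F i) A = \sum_(i <- r | P i) coef (F i) A.
Proof.
by elim/big_rec2: _ => [|i u v _ <-]; rewrite ?coef0 // coefD.
Qed.

Definition symdiff A B : {set 'I_n} := [set i | (i \in A) (+) (i \in B)].

(* Sorting the word e_A e_B swaps each pair i in A, j in B with j < i, and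
   then cancels each i in A and B by e_i ^ 2 = -1. *)
Definition blade_sign A B : R :=
  \prod_(i in A) \prod_(j in B) (if (j <= i)%N then -1 else 1).

Definition clifford_mul x y : Cl :=
  clifford_of (fun C => \sum_A coef x A * coef y (symdiff A C)
                                        * blade_sign A (symdiff A C)).

Definition blade A : Cl := clifford_of (fun B => (A == B)%:R).

Lemma symdiffA A B C : symdiff A (symdiff B C) = symdiff (symdiff A B) C.
Proof. by apply/setP => i; rewrite !inE addbA. Qed.

Lemma symdiffC A B : symdiff A B = symdiff B A.
Proof. by apply/setP => i; rewrite !inE addbC. Qed.

Lemma symdiffK A : involutive (symdiff A).
Proof. by move=> B; apply/setP => i; rewrite !inE addKb. Qed.

Lemma symdiff0 A : symdiff finset.set0 A = A.
Proof. by apply/setP => i; rewrite !inE. Qed.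

Lemma symdiff_0 A : symdiff A finset.set0 = A.
Proof. by rewrite symdiffC symdiff0. Qed.

Lemma prod_symdiff (F : 'I_n -> R) A B : (forall i, F i * F i = 1) ->
  \prod_(i in symdiff A B) F i = (\prod_(i in A) F i) * \prod_(i in B) F i.
Proof.
move=> F2.
rewrite (big_mkcond (fun i => i \in A)) (big_mkcond (fun i => i \in B)).
rewrite (big_mkcond (fun i => i \in symdiff A B)) -big_split /=.
apply: eq_bigr => i _; rewrite inE.
by case: (i \in A); case: (i \in B); rewrite /= ?mulr1 ?mul1r ?F2.
Qed.

Lemma sgn_sq (b : bool) : (if b then -1 else 1) * (if b then -1 else 1) = 1 :> R.
Proof. by case: b; rewrite ?mulr1 // mulrNN mulr1. Qed.

Lemma blade_signDl A B C :
  blade_sign (symdiff A B) C = blade_sign A C * blade_sign B C.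
Proof.
rewrite /blade_sign prod_symdiff // => i.
by rewrite -big_split big1 //= => j _; rewrite sgn_sq.
Qed.

Lemma blade_signDr A B C :
  blade_sign A (symdiff B C) = blade_sign A B * blade_sign A C.
Proof.
rewrite /blade_sign -big_split; apply: eq_bigr => i _.
by rewrite prod_symdiff // => j; rewrite sgn_sq.
Qed.

Lemma blade_sign0l A : blade_sign finset.set0 A = 1.
Proof. by rewrite /blade_sign big_set0. Qed.

Lemma blade_sign0r A : blade_sign A finset.set0 = 1.
Proof. by rewrite /blade_sign big1 // => i _; rewrite big_set0. Qed.

Fact clifford_mulA : associative clifford_mul.
Proof.
move=> x y z; apply: cliffordP => D; rewrite !coefE.
under eq_bigr do rewrite coefE mulr_sumr mulr_suml.
under [RHS]eq_bigr do rewrite coefE !mulr_suml.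
rewrite [RHS]exchange_big /=; apply: eq_bigr => A _.
rewrite [RHS](reindex_inj (inv_inj (symdiffK A))) /=.
apply: eq_bigr => B _; rewrite symdiffK.
have -> : symdiff (symdiff A B) D = symdiff B (symdiff A D).
  by rewrite symdiffA (symdiffC A).
set C := symdiff B (symdiff A D).
have -> : symdiff A D = symdiff B C by rewrite /C symdiffK.
by rewrite blade_signDl blade_signDr; ring.
Qed.

Fact clifford_mul1 : left_id (blade finset.set0) clifford_mul.
Proof.
move=> x; apply: cliffordP => C; rewrite coefE (bigD1 finset.set0) //= big1.
  by rewrite coefE eqxx symdiff0 blade_sign0l mul1r mulr1 addr0.
by move=> A A0; rewrite coefE eq_sym (negPf A0) !mul0r.
Qed.

Fact clifford_mulr1 : right_id (blade finset.set0) clifford_mul.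
Proof.
move=> x; apply: cliffordP => C; rewrite coefE (bigD1 C) //= big1.
  have -> : symdiff C C = finset.set0 by rewrite -{2}(symdiff_0 C) symdiffK.
  by rewrite coefE eqxx blade_sign0r !mulr1 addr0.
move=> A AC; rewrite coefE; case: eqP => [s0|_]; last by rewrite mulr0 mul0r.
by rewrite -(symdiffK A C) -s0 symdiff_0 eqxx in AC.
Qed.

Fact clifford_mulDl : left_distributive clifford_mul +%R.
Proof.
move=> x y z; apply: cliffordP => C; rewrite coefD !coefE -big_split.
by apply: eq_bigr => A _; rewrite coefD !mulrDl.
Qed.

Fact clifford_mulDr : right_distributive clifford_mul +%R.
Proof.
move=> x y z; apply: cliffordP => C; rewrite coefD !coefE -big_split.
by apply: eq_bigr => A _; rewrite coefD mulrDr mulrDl.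
Qed.

Fact clifford_1neq0 : blade finset.set0 != 0.
Proof.
apply/eqP => /(congr1 (fun x => coef x finset.set0))/eqP.
by rewrite coefE coef0 eqxx oner_eq0.
Qed.

#[warnings="-redundant-canonical-projection"]
HB.instance Definition _ := GRing.Zmodule_isNzRing.Build Cl
  clifford_mulA clifford_mul1 clifford_mulr1 clifford_mulDl clifford_mulDr
  clifford_1neq0.

Fact clifford_scaleAl (a : R) x y : a *: (x * y) = (a *: x) * y.
Proof.
apply: cliffordP => C; rewrite coefZ !coefE mulr_sumr.
by apply: eq_bigr => A _; rewrite coefZ !mulrA.
Qed.

#[warnings="-redundant-canonical-projection"]
HB.instance Definition _ := GRing.Lmodule_isLalgebra.Build R Cl clifford_scaleAl.

Fact clifford_scaleAr (a : R) x y : a *: (x * y) = x * (a *: y).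
Proof.
apply: cliffordP => C; rewrite coefZ !coefE mulr_sumr.
by apply: eq_bigr => A _; rewrite coefZ; ring.
Qed.

#[warnings="-redundant-canonical-projection"]
HB.instance Definition _ := GRing.Lalgebra_isAlgebra.Build R Cl clifford_scaleAr.

Definition gen (i : 'I_n) : Cl := blade [set i].

Lemma blade_mul A B : blade A * blade B = blade_sign A B *: blade (symdiff A B).
Proof.
apply: cliffordP => C; rewrite coefZ !coefE (bigD1 A) //= big1.
  rewrite !coefE eqxx mul1r addr0.
  have -> : (B == symdiff A C) = (symdiff A B == C).
    by rewrite -(inj_eq (inv_inj (symdiffK A))) symdiffK.
  by case: eqP => [<-|_]; rewrite ?symdiffK ?mulr1 ?mul1r ?mulr0 ?mul0r.
by move=> D DA; rewrite coefE eq_sym (negPf DA) !mul0r.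
Qed.

Lemma gen_anticomm (i j : 'I_n) :
  gen i * gen j + gen j * gen i = (- (2 * (i == j)%:R) : R)%:A.
Proof.
rewrite /gen !blade_mul (symdiffC [set j]) -scalerDl /blade_sign !big_set1.
case: (eqVneq i j) => [<-|ij].
  have -> : symdiff [set i] [set i] = finset.set0.
    by rewrite -{2}(symdiff_0 [set i]) symdiffK.
  by rewrite leqnn; congr (_ *: _); rewrite mulr1 -opprD.
rewrite mulr0 oppr0 scale0r.
have : (i : nat) != j by [].
by case: ltngtP => // _ _; rewrite ?addNr ?subrr scale0r.
Qed.

Lemma blade_prod A : blade A = \prod_(i <- enum A) gen i.
Proof.
have srt : sorted ltn (map val (enum A)).
  rewrite {1}/enum_mem -enumT.
  rewrite (subseq_sorted ltn_trans (map_subseq val (filter_subseq _ _))) //.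
  by rewrite val_enum_ord iota_ltn_sorted.
have -> : A = [set i in enum A] by apply/setP => i; rewrite inE mem_enum.
have -> : enum [set i in enum A] = enum A.
  by apply: eq_enum => i; rewrite inE mem_enum.
elim: (enum A) srt => [_|i s IH /= srt].
  by rewrite big_nil; congr blade; apply/setP => i; rewrite !inE.
have /allP ilt : all (ltn i) (map val s) := order_path_min ltn_trans srt.
have {}ilt (j : 'I_n) : j \in s -> (i < j)%N.
  by move=> js; apply: ilt; rewrite map_f.
rewrite big_cons -IH ?(path_sorted srt) // /gen blade_mul.
rewrite {1}/blade_sign big_set1 big1 ?scale1r; last first.
  by move=> j; rewrite inE => /ilt; rewrite ltnNge => /negPf ->.
congr blade; apply/setP => j; rewrite !inE.
by case: eqVneq => [->|] //=; case: (boolP (i \in s)) => // /ilt; rewrite ltnn.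
Qed.

Lemma clifford_sum_blade x : x = \sum_A coef x A *: blade A.
Proof.
apply: cliffordP => B; rewrite coef_sum (bigD1 B) //= big1.
  by rewrite coefZ coefE eqxx mulr1 addr0.
by move=> A AB; rewrite coefZ coefE (negPf AB) mulr0.
Qed.

End CliffordProduct.

Local Open Scope classical_set_scope.
Local Open Scope complex_scope.

Section FueterSce.
Variables (R : realType) (n : nat).
Local Notation Cl := (clifford R n).
Implicit Types x y : 'rV[R]_n.+1.

(* A point x = (x_0, ..., x_n) of R^(n+1); coordinate i + 1 goes with gen i. *)
Definition vec_part x : Cl := \sum_(i < n) x 0 (lift ord0 i) *: gen R i.
Definition paravector x : Cl := (x 0 0)%:A + vec_part x.
Definition paravector_conj x : Cl := (x 0 0)%:A - vec_part x.
Definition vec_norm x : R := Num.sqrt (\sum_(i < n) x 0 (lift ord0 i) ^+ 2).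

Definition cauchy_riemann (g : 'rV[R]_n.+1 -> Cl) x : Cl :=
  'D_(delta_mx 0 0) g x
  + \sum_(i < n) gen R i * 'D_(delta_mx 0 (lift ord0 i)) g x.

Definition clifford_holomorphic (U : set 'rV[R]_n.+1) (g : 'rV[R]_n.+1 -> Cl) :=
  forall x, U x ->
    (forall j, derivable g x (delta_mx 0 j)) /\ cauchy_riemann g x = 0.

Record is_appell (k : nat) (P : 'rV[R]_n.+1 -> Cl) : Prop := IsAppell {
  appell_form : exists T : 'I_k.+1 -> R, forall x,
    P x = \sum_(s < k.+1) T s *: (paravector x ^+ (k - s) * paravector_conj x ^+ s);
  appell_holomorphic : clifford_holomorphic setT P;
  appell_homogeneous : forall (t : R) x, P (t *: x) = t ^+ k *: P x;
  appell_normalized : P (delta_mx 0 0) = 1 }.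

(* "The" P satisfying is_appell; the default value 0 is never normalized. *)
Definition appell (k : nat) : 'rV[R]_n.+1 -> Cl :=
  xget (fun=> 0) [set P | is_appell k P].

(* (r^-1 d/dr)^q *)
Definition radial_u (q : nat) (h : R -> R) : R -> R :=
  iter q (fun (g : R -> R) r => r^-1 * derive1 g r) h.

(* (d/dr r^-1)^q *)
Definition radial_v (q : nat) (h : R -> R) : R -> R :=
  iter q (fun g : R -> R => derive1 (fun r => r^-1 * g r)) h.

(* Meaningful only where vec_norm x != 0. *)
Definition fueter_sce_off_axis (alpha : R) (f : R[i] -> R[i]) x : Cl :=
  let r := vec_norm x in
  let u (s : R) := complex.Re (f (x 0 0 +i* s)) in
  let v (s : R) := complex.Im (f (x 0 0 +i* s)) in
  alpha *: ((radial_u n.-1./2 u r)%:A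
            + (r^-1 *: vec_part x) * (radial_v n.-1./2 v r)%:A).

Definition fueter_sce (alpha : R) (f : R[i] -> R[i]) x : Cl :=
  if vec_norm x == 0 then
    lim (fueter_sce_off_axis alpha f y
           @[y --> within [set y | vec_norm y != 0] (nbhs x)])
  else fueter_sce_off_axis alpha f x.

End FueterSce.

Fixpoint double_fact (m : nat) : nat :=
  if m is p.+2 then (m * double_fact p)%N else 1%N.

(* For m >= n - 1, the truncated m.+1 - n is m - n + 1. *)
Definition fueter_sce_const (R : realType) (n m : nat) : R :=
  (-1) ^+ n.-1./2 * (double_fact (n - 2))%:R * (m.+1 - n)`!%:R / m`!%:R.

(* Main.v *)
(** Write [w] for the scalar part of [x] and [X] for its vector part, so that
    [X ^ 2 = - |X| ^ 2].  Since [w] and [X] commute, the polynomials of the form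
    [sum_s T_s x^(k-s) xbar^s] are exactly those of the form
    [sum_l b_l w^(k-l) X^l].  The Cauchy-Riemann operator maps [w^a X^l] to
    [a w^(a-1) X^l - beta_l w^a X^(l-1)], with [beta_l = l] for even [l] and
    [beta_l = l + n - 1] for odd [l], so such a polynomial is holomorphic iff
    [(k - l) b_l = beta_(l+1) b_(l+1)] for all [l < k]; together with [b_0 = 1]
    this determines [b].  On the other side, write [n = 2q + 1] and
    [(w + i s)^(k+2q) = A(s^2) + i s B(s^2)].  The two radial operators turn
    [A(s^2)] into [2^q A^(q)(s^2)] and [s B(s^2)] into [s 2^q B^(q)(s^2)], whose
    coefficients satisfy the same recurrence.  Points with [X = 0] follow by
    continuity. *)

Require Import Defs.
From mathcomp Require Import all_boot all_order all_algebra.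
From mathcomp Require Import all_classical all_reals all_analysis.
From mathcomp Require Import complex ring zify.
Set Implicit Arguments.
Unset Strict Implicit.
Unset Printing Implicit Defensive.
Import Order.TTheory GRing.Theory Num.Theory.
Import numFieldNormedType.Exports.
Local Open Scope classical_set_scope.
Local Open Scope ring_scope.

(** * The vector part [X]: its square, powers and directional derivatives *)

Lemma is_derive_scale (R : realType) (V W : normedModType R) (f : V -> R)
    (c : W) (x v : V) (df : R) :
  is_derive x v f df -> is_derive x v (fun y => f y *: c) (df *: c).
Proof.
move=> [fD <-].
have cv : (fun h => h^-1 *: (((fun y => f y *: c) \o shift x) (h *: v)
    - f x *: c)) @ 0^' --> 'D_v f x *: c.
  rewrite (_ : (fun h => _) =
    fun h => (h^-1 *: ((f \o shift x) (h *: v) - f x)) *: c); last first.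
    by apply/funext => h /=; rewrite -scalerBl scalerA.
  exact: cvgZr_tmp fD.
by split; [exact: cvgP cv | exact: cvg_lim cv].
Qed.

Section VecPart.
Variables (R : realType) (n : nat).
Local Notation Cl := (clifford R n).
Local Notation pt := 'rV[R]_n.+1.
Implicit Types (x v : pt).

Definition vec_sqnorm x : R := \sum_(i < n) x 0 (lift ord0 i) ^+ 2.

Lemma sqr_vec_norm x : vec_norm x ^+ 2 = vec_sqnorm x.
Proof. by rewrite sqr_sqrtr // sumr_ge0 // => i _; rewrite sqr_ge0. Qed.

Lemma vec_partZ (t : R) x : vec_part (t *: x) = t *: vec_part x.
Proof.
by rewrite /vec_part scaler_sumr; apply: eq_bigr => i _; rewrite mxE scalerA.
Qed.

Lemma gen_sqr (i : 'I_n) : gen R i * gen R i = - 1.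
Proof.
have := gen_anticomm R i i; rewrite eqxx mulr1 -mulr2n -(scaler_nat 2).
rewrite scaleNr -scalerN => /(scalerI _); apply.
by rewrite pnatr_eq0.
Qed.

(** The square is doubled and one copy is summed in the opposite order, so that the pairs [(i, j)]
    and [(j, i)] combine into anticommutators, which vanish off the diagonal. *)
Lemma vec_part_sqr x : vec_part x ^+ 2 = (- vec_sqnorm x)%:A.
Proof.
apply: (@scalerI R _ 2); first by rewrite pnatr_eq0.
rewrite scaler_nat mulr2n {1}expr2 /vec_part mulr_suml.
under eq_bigr do rewrite mulr_sumr.
rewrite expr2 mulr_suml; under [X in _ + X]eq_bigr do rewrite mulr_sumr.
rewrite [X in _ + X]exchange_big -big_split /=.
under eq_bigr do rewrite -big_split /=.
rewrite scalerA mulrN scaleNr /vec_sqnorm mulr_sumr scaler_suml -sumrN.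
apply: eq_bigr => i _; rewrite (bigD1 i) //= big1 ?addr0; last first.
  move=> j ji; rewrite -!scalerAl -!scalerAr !scalerA.
  rewrite (mulrC (x 0 (lift ord0 j))) -scalerDr gen_anticomm.
  by rewrite eq_sym (negPf ji) mulr0 oppr0 scale0r scaler0.
rewrite -!scalerAl -!scalerAr !scalerA gen_sqr -!scalerDr -expr2.
rewrite -opprD -mulr2n scalerN -(scaler_nat 2 (1 : Cl)) scalerA.
by congr (- (_ *: _)); rewrite /GRing.scale /=; ring.
Qed.

(** Since [X ^ 2] is real, every power of [X] is a real factor times [X ^ 0] or [X ^ 1];
    differentiation and continuity of [X ^ l] thus reduce to real functions and a linear map. *)
Lemma vec_partX x l :
  vec_part x ^+ l = (- vec_sqnorm x) ^+ l./2 *: vec_part x ^+ odd l.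
Proof.
rewrite -{1}(odd_double_half l) exprD -mul2n exprM vec_part_sqr exprZn expr1n.
by rewrite -scalerAr mulr1.
Qed.

Lemma is_derive_coord x v j : is_derive x v (fun y : pt => y 0 j) (v 0 j).
Proof.
have /derivable_mxP idD := @derivable_id R pt x v.
split; first exact: idD.
have := derive_mx (@derivable_id R pt x v); rewrite derive_id.
by move=> /(congr1 (fun M : pt => M 0 j)); rewrite mxE.
Qed.

Lemma is_derive_vec_sqnorm x v :
  is_derive x v vec_sqnorm
    (2 * \sum_(i < n) x 0 (lift ord0 i) * v 0 (lift ord0 i)).
Proof.
have -> : vec_sqnorm = \sum_(i < n) (fun y : pt => y 0 (lift ord0 i)) ^+ 2.
  by apply/funext => y; rewrite fct_sumE; apply: eq_bigr => i _.
apply: is_derive_eq; first apply: is_derive_sum => i.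
  exact: is_deriveX (is_derive_coord x v (lift ord0 i)).
by rewrite mulr_sumr; apply: eq_bigr => i _; rewrite expr1 mulrA.
Qed.

(** The boolean exponent is the parity left over by [vec_partX]. For [b = true], expanding [X] in
    generators leaves real functions times fixed vectors. *)
Lemma is_derive_scale_vec_part (g : pt -> R) x v dg (b : bool) :
  is_derive x v g dg ->
  is_derive x v (fun y => g y *: vec_part y ^+ b)
    (dg *: vec_part x ^+ b + (b%:R * g x) *: vec_part v).
Proof.
move=> gD; case: b => /=; last first.
  rewrite mul0r scale0r addr0 expr0.
  exact: is_derive_scale.
have -> : (fun y => g y *: vec_part y ^+ 1) = \sum_(i < n)
    (fun y => (g * (fun z : pt => z 0 (lift ord0 i))) y *: gen R i).
  apply/funext => y; rewrite fct_sumE expr1 scaler_sumr.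
  by apply: eq_bigr => i _; rewrite scalerA.
apply: is_derive_eq; first apply: is_derive_sum => i.
  exact: is_derive_scale (is_deriveM gD (is_derive_coord x v (lift ord0 i))).
rewrite expr1 mul1r !scaler_sumr -big_split; apply: eq_bigr => i _ /=.
by rewrite scalerDl !scalerA addrC [x _ _ *: _]mulrC.
Qed.

End VecPart.

(** * The Cauchy-Riemann operator on homogeneous forms in [w] and [X] *)

Section CauchyRiemannForm.
Variables (R : realType) (n : nat).
Local Notation Cl := (clifford R n).
Local Notation pt := 'rV[R]_n.+1.
Implicit Types (x v : pt).

Lemma is_derive_monomial a l x v :
  is_derive x v (fun y : pt => y 0 0 ^+ a *: vec_part y ^+ l)
    ((a%:R * x 0 0 ^+ a.-1 * v 0 0 * (- vec_sqnorm x) ^+ l./2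
      - x 0 0 ^+ a * l./2%:R * (- vec_sqnorm x) ^+ l./2.-1 * 2
          * \sum_(i < n) x 0 (lift ord0 i) * v 0 (lift ord0 i))
       *: vec_part x ^+ odd l
     + ((odd l)%:R * x 0 0 ^+ a * (- vec_sqnorm x) ^+ l./2) *: vec_part v).
Proof.
have -> : (fun y : pt => y 0 0 ^+ a *: vec_part y ^+ l) =
    fun y => (((fun y : pt => y 0 0) ^+ a) * (- @vec_sqnorm R n) ^+ l./2) y
      *: vec_part y ^+ odd l.
  by apply/funext => y; rewrite vec_partX scalerA /= !fctE.
apply: is_derive_eq; first apply: is_derive_scale_vec_part.
  apply: is_deriveM.
    exact: is_deriveX (is_derive_coord x v 0).
  exact: is_deriveX (is_deriveN (is_derive_vec_sqnorm x v)).
congr (_ *: _ + _ *: _).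
  rewrite /GRing.scale /= !fctE /=.
  ring.
by rewrite /= !fctE mulrA.
Qed.

(* The factor [beta_l] in [sum_i e_i d_i X^l = - beta_l X^(l-1)]. *)
Definition dirac_coef (l : nat) : R := l%:R + (odd l)%:R * (n%:R - 1).

Lemma vec_part_delta0 : vec_part (delta_mx 0 0 : pt) = 0.
Proof.
rewrite /vec_part big1 // => i _.
by rewrite mxE eqxx /= ?eq_liftF ?lift_eqF scale0r.
Qed.

Lemma vec_part_delta (i : 'I_n) :
  vec_part (delta_mx 0 (lift ord0 i) : pt) = gen R i.
Proof.
rewrite /vec_part (bigD1 i) //= big1 => [|j ji].
  by rewrite mxE !eqxx scale1r addr0.
by rewrite mxE eqxx /= (inj_eq (@lift_inj _ _)) (negPf ji) scale0r.
Qed.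

(** Differentiating [|X| ^ 2] along [e_i] yields [2 x_i], and [sum_i x_i e_i = X]; differentiating a
    remaining factor [X] yields [e_i e_i = -1], counted [n] times. The truncated exponents at
    [a = 0] and [l = 0] carry a zero factor. *)
Lemma cauchy_riemann_monomial a l x :
  cauchy_riemann (fun y : pt => y 0 0 ^+ a *: vec_part y ^+ l) x =
    (a%:R * x 0 0 ^+ a.-1) *: vec_part x ^+ l
    - (dirac_coef l * x 0 0 ^+ a) *: vec_part x ^+ l.-1.
Proof.
have der v := @derive_val _ _ _ _ _ _ _ (is_derive_monomial a l x v).
rewrite /cauchy_riemann; under eq_bigr do rewrite der.
rewrite der.
rewrite vec_part_delta0 scaler0 addr0 big1 ?mulr0 ?subr0; last first.
  by move=> i _; rewrite mxE eqxx /= ?eq_liftF ?lift_eqF mulr0.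
rewrite [delta_mx 0 0 0 0]mxE !eqxx mulr1 -scalerA -vec_partX.
congr (_ + _).
have -> : \sum_(i < n) gen R i * ((a%:R * x 0 0 ^+ a.-1 *
      (delta_mx 0 (lift ord0 i) : pt) 0 0 * (- vec_sqnorm x) ^+ l./2
      - x 0 0 ^+ a * l./2%:R * (- vec_sqnorm x) ^+ l./2.-1 * 2 *
        (\sum_(i0 < n) x 0 (lift ord0 i0) *
           (delta_mx 0 (lift ord0 i) : pt) 0 (lift ord0 i0)))
        *: vec_part x ^+ odd l +
      ((odd l)%:R * x 0 0 ^+ a * (- vec_sqnorm x) ^+ l./2)
        *: vec_part (delta_mx 0 (lift ord0 i)))
  = - (x 0 0 ^+ a * l./2%:R * (- vec_sqnorm x) ^+ l./2.-1 * 2)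
      *: (vec_part x * vec_part x ^+ odd l)
    - ((odd l)%:R * x 0 0 ^+ a * (- vec_sqnorm x) ^+ l./2 * n%:R)%:A :> Cl.
  have -> : vec_part x * vec_part x ^+ odd l = \sum_(i < n)
      x 0 (lift ord0 i) *: (gen R i * vec_part x ^+ odd l).
    rewrite {1}/vec_part mulr_suml.
    by apply: eq_bigr => i _; rewrite scalerAl.
  rewrite scaler_sumr.
  have nA (c : R) : (c * n%:R)%:A = \sum_(i < n) c%:A :> Cl.
    by rewrite sumr_const card_ord mulr_natr scalerMnl.
  rewrite nA.
  rewrite -sumrB.
  apply: eq_bigr => i _.
  rewrite vec_part_delta mulrDr -!scalerAr gen_sqr scalerN.
  congr (_ - _); rewrite scalerA; congr (_ *: _).
  rewrite mxE eqxx /= ?eq_liftF ?lift_eqF mulr0 mul0r sub0r.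
  rewrite (bigD1 i) //= big1 => [|j ji]; last first.
    by rewrite mxE eqxx /= (inj_eq (@lift_inj _ _)) (negPf ji) mulr0.
  by rewrite mxE !eqxx mulr1 addr0 mulNr.
rewrite -exprS /dirac_coef.
(* For [l = 2j + 1] the two contributions add up to [2j + n = l + n - 1]; for [l = 2j] only the
   first one, [2j], is present. *)
move: (odd_double_half l); case: (odd l) => /=; set j := l./2 => <-.
  rewrite add1n /= -mul2n exprM vec_part_sqr exprZn expr1n.
  rewrite !scalerA -!scaleNr -scalerDl; congr (_ *: _).
  rewrite /GRing.scale /=.
  by case: j => [|j]; rewrite /= ?exprS; ring.
rewrite add0n expr1 !mul0r scale0r subr0 addr0.
case: j => [|j]; first by rewrite !mulr0 !mul0r oppr0 !scale0r oppr0.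
rewrite doubleS [_.-1]/= exprSr -mul2n exprM vec_part_sqr exprZn expr1n.
rewrite (mulr_algl _ (vec_part x)) (scalerA _ _ (vec_part x)).
rewrite -(scaleNr _ (vec_part x)).
by congr (_ *: _); rewrite /=; ring.
Qed.

Definition vec_form (b : nat -> R) (k : nat) x : Cl :=
  \sum_(l < k.+1) b l *: (x 0 0 ^+ (k - l) *: vec_part x ^+ l).

Lemma is_derive_vec_form b k x v : {df | is_derive x v (vec_form b k) df}.
Proof.
have -> : vec_form b k = \sum_(l < k.+1)
    (b l \*: (fun y : pt => y 0 0 ^+ (k - l) *: vec_part y ^+ l)).
  by apply/funext => y; rewrite fct_sumE.
eexists; apply: is_derive_sum => l.
apply: is_deriveZ; exact: is_derive_monomial.
Qed.

Lemma cauchy_riemann_vec_form b k x :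
  cauchy_riemann (vec_form b k) x = \sum_(l < k)
    (b l * (k - l)%:R - b l.+1 * dirac_coef l.+1)
      *: (x 0 0 ^+ (k - l.+1) *: vec_part x ^+ l).
Proof.
have der v : 'D_v (vec_form b k) x = \sum_(l < k.+1)
    b l *: 'D_v (fun y : pt => y 0 0 ^+ (k - l) *: vec_part y ^+ l) x.
  have -> : vec_form b k = \sum_(l < k.+1)
      (b l \*: (fun y : pt => y 0 0 ^+ (k - l) *: vec_part y ^+ l)).
    by apply/funext => y; rewrite fct_sumE.
  have mD (l : nat) := is_derive_monomial (k - l) l x v.
  rewrite derive_sum; last by move=> l; apply: derivableZ; have [] := mD l.
  by apply: eq_bigr => l _; rewrite deriveZ //; have [] := mD l.
have -> : cauchy_riemann (vec_form b k) x = \sum_(l < k.+1) b l *: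
    cauchy_riemann (fun y : pt => y 0 0 ^+ (k - l) *: vec_part y ^+ l) x.
  rewrite /cauchy_riemann; under eq_bigr do rewrite der mulr_sumr.
  rewrite der.
  rewrite exchange_big -big_split; apply: eq_bigr => l _ /=.
  rewrite scalerDr scaler_sumr; congr (_ + _).
  by apply: eq_bigr => i _; rewrite scalerAr.
under eq_bigr do rewrite cauchy_riemann_monomial scalerBr.
(* The [w]-derivative kills the term [l = k] and the vector derivatives kill [l = 0]; shifting the
   second sum by one aligns both over [l < k]. *)
rewrite sumrB big_ord_recr /= subnn mul0r scale0r scaler0 addr0.
rewrite big_ord_recl /dirac_coef /= mul0r addr0 mul0r scale0r scaler0 add0r.
rewrite -sumrB; apply: eq_bigr => l _ /=.
rewrite -subn1 -subnDA addn1 !scalerA -scalerBl; congr (_ *: _).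
by rewrite /GRing.scale /= /bump leq0n add1n add0n; ring.
Qed.

End CauchyRiemannForm.

(** * Linear substitutions in homogeneous forms of two commuting elements *)

Section BinaryForms.
Variables (R : realType) (A : algType R).
Implicit Types (u v : A) (g h : A -> A -> A).

(** The coefficients are chosen before [u] and [v], so that a single family serves every point
    [x]. *)
Definition is_binary_form k g := exists T : nat -> R, forall u v,
  u * v = v * u -> g u v = \sum_(s < k.+1) T s *: (u ^+ (k - s) * v ^+ s).

Lemma binary_form0 k : is_binary_form k (fun _ _ => 0).
Proof.
by exists (fun=> 0) => u v _; rewrite big1 // => s _; rewrite scale0r.
Qed.

Lemma binary_form_lin k a g h : is_binary_form k g -> is_binary_form k h ->
  is_binary_form k (fun u v => a *: g u v + h u v).
Proof.
move=> [T gT] [S hS]; exists (fun s => a * T s + S s) => u v uv.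
rewrite gT // hS // scaler_sumr -big_split; apply: eq_bigr => s _ /=.
by rewrite scalerDl scalerA.
Qed.

Lemma binary_form_mul k c d g : is_binary_form k g ->
  is_binary_form k.+1 (fun u v => (c *: u + d *: v) * g u v).
Proof.
move=> [T gT].
(* The new coefficients are [c T_s + d T_(s-1)], with [T_(-1)] and [T_(k+1)] read as 0. *)
exists (fun s => (if (s <= k)%N then c * T s else 0)
               + (if s is s'.+1 then d * T s' else 0)) => u v uv.
under [RHS]eq_bigr do rewrite scalerDl.
rewrite big_split big_ord_recr /= ltnn /= scale0r addr0.
rewrite [X in _ = _ + X]big_ord_recl /= scale0r add0r.
rewrite gT // mulrDl !mulr_sumr; congr (_ + _); apply: eq_bigr => s _.
  rewrite -ltnS ltn_ord -scalerA -!scalerAr -scalerAl scalerA mulrC -scalerA.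
  by congr (_ *: (_ *: _)); rewrite mulrA -exprS subSn // -ltnS.
rewrite -scalerAr -scalerAl scalerA mulrC; congr (_ *: _).
rewrite /= /bump /= add1n subSS exprS !mulrA; congr (_ * _).
exact/commrX.
Qed.

Lemma binary_form_linX c d e f i j :
  is_binary_form (i + j)
    (fun u v => (c *: u + d *: v) ^+ i * (e *: u + f *: v) ^+ j).
Proof.
elim: i => [|i IH]; last first.
  have [T gT] := binary_form_mul c d IH.
  by exists T => u v uv; rewrite exprS -mulrA gT.
elim: j => [|j IH].
  exists (fun=> 1) => u v _.
  by rewrite big_ord_recl big_ord0 !expr0 mulr1 scale1r addr0.
have [T gT] := binary_form_mul e f IH.
by exists T => u v uv; rewrite -gT // !expr0 !mul1r exprS.
Qed.

(** Serves in both directions: from [x], [xbar] to [w], [X] and back. The number of summands is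
    decoupled from the degree [k] to allow induction on it. *)
Lemma binary_form_subst c d e f k (b : nat -> R) :
  is_binary_form k (fun u v => \sum_(l < k.+1)
    b l *: ((c *: u + d *: v) ^+ (k - l) * (e *: u + f *: v) ^+ l)).
Proof.
suff H m : (m <= k.+1)%N -> is_binary_form k (fun u v => \sum_(l < m)
    b l *: ((c *: u + d *: v) ^+ (k - l) * (e *: u + f *: v) ^+ l)) by exact: H.
elim: m => [_|m IH mk].
  have [T gT] := binary_form0 k.
  by exists T => u v uv; rewrite big_ord0 -gT.
have := binary_form_linX c d e f (k - m) m; rewrite subnK // => gm.
have [T gT] := binary_form_lin (b m) gm (IH (ltnW mk)).
by exists T => u v uv; rewrite -gT // big_ord_recr [LHS]addrC.
Qed.

End BinaryForms.

(** * Existence and uniqueness of the Appell polynomial through its coefficients in [w] and [X] *)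

Section AppellCharacterization.
Variables (R : realType) (n : nat).
Hypothesis n_gt0 : (0 < n)%N.
Local Notation Cl := (clifford R n).
Local Notation pt := 'rV[R]_n.+1.
Implicit Types (x v : pt) (b : nat -> R).

Lemma vec_form_binary b k x : vec_form b k x =
  \sum_(l < k.+1) b l *: ((x 0 0)%:A ^+ (k - l) * vec_part x ^+ l).
Proof.
by apply: eq_bigr => l _; rewrite exprZn expr1n (mulr_algl _ (_ ^+ l)).
Qed.

Lemma paravector_conj_comm x :
  paravector x * paravector_conj x = paravector_conj x * paravector x.
Proof.
have cA (y : Cl) : GRing.comm y (x 0 0)%:A.
  by rewrite /GRing.comm mulr_algl mulr_algr.
apply: commrB; first exact: cA.
by apply/commr_sym/commrD; [exact: cA | exact: commr_refl].
Qed.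

Lemma appell_form_vec_form k (T : 'I_k.+1 -> R) :
  exists b, forall x, \sum_(s < k.+1)
    T s *: (paravector x ^+ (k - s) * paravector_conj x ^+ s) = vec_form b k x.
Proof.
have [b Hb] := @binary_form_subst R Cl 1 1 1 (-1) k (fun s => T (inord s)).
exists b => x; rewrite vec_form_binary -Hb; last by rewrite mulr_algl mulr_algr.
by apply: eq_bigr => s _; rewrite inord_val !scale1r scaleN1r.
Qed.

Lemma vec_form_appell_form b k :
  exists T : 'I_k.+1 -> R, forall x, vec_form b k x = \sum_(s < k.+1)
    T s *: (paravector x ^+ (k - s) * paravector_conj x ^+ s).
Proof.
(* Here [w = (x + xbar) / 2] and [X = (x - xbar) / 2]. *)
have [T HT] := @binary_form_subst R Cl 2^-1 2^-1 2^-1 (- 2^-1) k b.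
exists (fun s => T s) => x; rewrite vec_form_binary.
have half (y : Cl) : 2^-1 *: (y + y) = y.
  by rewrite -mulr2n -(scaler_nat 2 y) scalerA mulVf ?scale1r // pnatr_eq0.
rewrite -HT; last exact: paravector_conj_comm.
have -> : 2^-1 *: paravector x + 2^-1 *: paravector_conj x = (x 0 0)%:A.
  by rewrite -scalerDr addrACA subrr addr0 half.
have -> // : 2^-1 *: paravector x + - 2^-1 *: paravector_conj x = vec_part x.
by rewrite scaleNr -scalerBr opprB addrC addrA subrK half.
Qed.

(** In characteristic 0 the numbers [0, ..., size p - 1] are distinct roots, too many for a nonzero
    [p]. *)
Lemma horner_eq0 (p : {poly R}) : (forall t, p.[t] = 0) -> p = 0.
Proof.
move=> p0; apply: (@roots_geq_poly_eq0 _ p [seq i%:R | i <- iota 0 (size p)]).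
- by apply/allP => t _; apply/rootP.
- by rewrite map_inj_uniq ?iota_uniq //; exact: mulrIn (oner_neq0 R).
- by rewrite size_map size_iota.
Qed.

(** On the line [1 + t e_1] the relation becomes [sum_l c_l t^l e_1^l = 0]; any one coordinate of it
    is a real polynomial in [t] vanishing everywhere. *)
Lemma vec_monomials_free k (c : nat -> R) :
  (forall x,
    \sum_(l < k) c l *: (x 0 0 ^+ (k - l.+1) *: vec_part x ^+ l) = 0) ->
  forall l, (l < k)%N -> c l = 0.
Proof.
move=> c0 l lk; pose g := gen R (Ordinal n_gt0).
pose xt t : pt := delta_mx 0 0 + t *: delta_mx 0 (lift ord0 (Ordinal n_gt0)).
have xt0 t : xt t 0 0 = 1 by rewrite !mxE !eqxx /= mulr0 addr0.
have xtv t : vec_part (xt t) = t *: g.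
  rewrite /g -vec_part_delta -vec_partZ /vec_part; apply: eq_bigr => i _.
  by rewrite !mxE /= add0r.
(* The generator is invertible with inverse [- g], hence so are its powers. *)
have gl : g ^+ l != 0.
  have gN : g * - g = 1 by rewrite mulrN gen_sqr opprK.
  have : g ^+ l * (- g) ^+ l = 1.
    by rewrite -exprMn_comm ?gN ?expr1n // /GRing.comm mulrN mulNr.
  by apply: contra_eq_neq => ->; rewrite mul0r eq_sym oner_eq0.
(* The blade [A] is adapted to the given [l]: it makes the coefficient of [t^l] a nonzero multiple
   of [c l]. *)
have [A gA] : exists A, coef (g ^+ l) A != 0.
  apply: contra_notP (negP gl) => H; apply/eqP/cliffordP => A.
  rewrite Defs.coef0; apply/eqP; apply: contra_notT H => gA; by exists A.
pose p := \poly_(i < k) (c i * coef (g ^+ i) A).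
have p0 : p = 0.
  apply: horner_eq0 => t; rewrite horner_poly.
  have := congr1 (fun y => coef y A) (c0 (xt t)).
  rewrite Defs.coef0 Defs.coef_sum => e; rewrite -[RHS]e; apply: eq_bigr => i _.
  by rewrite xt0 xtv expr1n scale1r exprZn !Defs.coefZ; ring.
have := congr1 (fun q : {poly R} => q`_l) p0.
rewrite coef_poly lk poly.coef0 => /eqP; rewrite mulf_eq0 (negPf gA) orbF.
by move/eqP.
Qed.

Lemma dirac_coef_gt0 l : 0 < dirac_coef R n l.+1.
Proof.
rewrite /dirac_coef ltr_wpDr ?ltr0n // mulr_ge0 ?ler0n // subr_ge0 ler1n //.
Qed.

Lemma vec_form_holomorphicP b k :
  clifford_holomorphic setT (vec_form b k : pt -> Cl) <->
  forall l, (l < k)%N -> b l * (k - l)%:R = b l.+1 * dirac_coef R n l.+1.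
Proof.
split=> [hol l lk|rec x _].
  apply/subr0_eq; move: l lk; apply: vec_monomials_free => x.
  by rewrite -cauchy_riemann_vec_form; have [] := hol x I.
split=> [j|]; first by have [df []] := is_derive_vec_form b k x (delta_mx 0 j).
rewrite cauchy_riemann_vec_form big1 // => l _.
by rewrite rec // subrr scale0r.
Qed.

Lemma vec_form_delta0 b k : vec_form b k (delta_mx 0 0 : pt) = (b 0%N)%:A.
Proof.
rewrite /vec_form big_ord_recl big1 => [|l _].
  by rewrite mxE !eqxx !expr1n addr0 scale1r.
by rewrite vec_part_delta0 expr0n scaler0 scaler0.
Qed.

Lemma vec_form_homogeneous b k (t : R) x :
  vec_form b k (t *: x) = t ^+ k *: vec_form b k x.
Proof.
rewrite scaler_sumr; apply: eq_bigr => l _.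
rewrite vec_partZ mxE exprMn exprZn !scalerA; congr (_ *: _).
have -> : t ^+ k = t ^+ (k - l) * t ^+ l by rewrite -exprD subnK // -ltnS.
by ring.
Qed.

Lemma appell_vec_form b k : b 0%N = 1 ->
  (forall l, (l < k)%N -> b l * (k - l)%:R = b l.+1 * dirac_coef R n l.+1) ->
  appell k = vec_form b k :> (pt -> Cl).
Proof.
move=> b0 rec; apply: xget_unique.
  split; first exact: vec_form_appell_form.
  - exact/vec_form_holomorphicP.
  - exact: vec_form_homogeneous.
  - by rewrite vec_form_delta0 b0 scale1r.
(* Uniqueness: any other candidate is also a form in [w] and [X], whose coefficients [c] obey the
   same recurrence. *)
move=> P [[T PT] hol _ P1].
have [c Tc] := appell_form_vec_form T.
have Pc : P = vec_form c k by apply/funext => x; rewrite PT Tc.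
rewrite {}Pc {PT Tc} in hol P1 *.
move/vec_form_holomorphicP: hol => crec.
have c0 : c 0%N = 1.
  have := congr1 (fun y : Cl => coef y finset.set0) P1.
  rewrite vec_form_delta0 Defs.coefZ -[X in _ = X]mul1r; apply: mulIf.
  by rewrite Defs.coefE eqxx oner_eq0.
apply/funext => x; apply: eq_bigr => -[l lk] _ /=; congr (_ *: _).
elim: l lk => [|l IH] lk; first by rewrite b0.
(* As [beta_(l+1)] is positive, the recurrence determines each coefficient from the preceding
   one. *)
apply: (mulIf (lt0r_neq0 (dirac_coef_gt0 l))).
by rewrite -rec // -crec // IH // ltnW.
Qed.

End AppellCharacterization.

(** * The radial operators on polynomials in [s ^ 2], and the parts of a complex power *)

Section Radial.
Variable R : realType.
Implicit Types (p : {poly R}) (g h : R -> R).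

(** Agreement off 0 suffices, being agreement near [s]. This ignores the values at 0 of the iterated
    radial operators, which divide by [r]. *)
Lemma derive1_horner_off0 p g s : s != 0 ->
  (forall t, t != 0 -> g t = p.[t]) -> derive1 g s = p^`().[s].
Proof.
move=> s0 gp; rewrite derive1E derivE derive1E.
apply: near_eq_derive; near=> t; apply: gp.
by near: t; apply: (cvgr_neq0 _ (@cvg_id _ (nbhs s))).
Unshelve. all: by end_near. Qed.

Lemma deriv_comp_sqr p : (p \Po 'X^2)^`() = (p^`() \Po 'X^2) * (2 *: 'X).
Proof. by rewrite deriv_comp derivXn scaler_nat. Qed.

(** With [t = r ^ 2], the operator [r^-1 d/dr] is [2 d/dt]. *)
Lemma radial_u_horner p q h s : s != 0 ->
  (forall t, t != 0 -> h t = p.[t ^+ 2]) ->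
  radial_u q h s = 2 ^+ q * p^`(q).[s ^+ 2].
Proof.
move=> s0 hp; elim: q s s0 => [|q IH] s s0; first by rewrite /= hp // mul1r.
rewrite /radial_u iterS -/(radial_u q h).
rewrite (@derive1_horner_off0 (2 ^+ q *: (p^`(q) \Po 'X^2))) // => [|t t0].
  rewrite derivZ deriv_comp_sqr derivnS (exprS 2 q).
  rewrite !(hornerZ, hornerM, horner_comp, hornerXn, hornerX).
  by field.
by rewrite IH // !(hornerZ, hornerM, horner_comp, hornerXn, hornerX).
Qed.

(** Dividing [r p(r ^ 2)] by [r] and then differentiating gives [r * 2 p'(r ^ 2)], of the same shape
    again. *)
Lemma radial_v_horner p q h s : s != 0 ->
  (forall t, t != 0 -> h t = t * p.[t ^+ 2]) ->
  radial_v q h s = s * (2 ^+ q * p^`(q).[s ^+ 2]).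
Proof.
move=> s0 hp; elim: q s s0 => [|q IH] s s0; first by rewrite /= hp // mul1r.
rewrite /radial_v iterS -/(radial_v q h).
rewrite (@derive1_horner_off0 (2 ^+ q *: (p^`(q) \Po 'X^2))) // => [|t t0].
  rewrite derivZ deriv_comp_sqr derivnS (exprS 2 q).
  rewrite !(hornerZ, hornerM, horner_comp, hornerXn, hornerX).
  by ring.
by rewrite IH // mulKf // !(hornerZ, hornerM, horner_comp, hornerXn, hornerX).
Qed.

(** The binomial expansion split by the parity of the power of [i s], obtained by induction from
    Pascal's rule. *)
Lemma complex_exp_horner (w : R) m : exists A B : {poly R},
  [/\ forall s, (w +i* s)%C ^+ m = (A.[s ^+ 2] +i* (s * B.[s ^+ 2]))%C,
      forall j, A`_j = (-1) ^+ j * 'C(m, j.*2)%:R * w ^+ (m - j.*2)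
    & forall j, B`_j = (-1) ^+ j * 'C(m, j.*2.+1)%:R * w ^+ (m - j.*2.+1)].
Proof.
have pascal m' l : 'C(m'.+1, l.+1)%:R * w ^+ (m'.+1 - l.+1) =
    'C(m', l)%:R * w ^+ (m' - l) + w * ('C(m', l.+1)%:R * w ^+ (m' - l.+1)).
  rewrite binS natrD mulrDl addrC subSS; congr (_ + _).
  have [lm|ml] := ltnP l m'; last by rewrite bin_small // !mul0r mulr0.
  by rewrite -[in LHS](subnSK lm) exprS; ring.
elim: m => [|m [A [B [AB Aj Bj]]]].
  exists 1, 0; split=> [s|j|j].
  - by rewrite expr0 !hornerE.
  - rewrite coef1; case: j => [|j] /=; first by rewrite bin0 !mulr1.
    by rewrite bin0n mulr0 mul0r.
  - by rewrite poly.coef0 bin0n mulr0 mul0r.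
(* These are the parts of [(w + i s)(A + i s B)], with ['X] standing for [s ^ 2]. *)
exists (w *: A - 'X * B), (A + w *: B); split=> [s|j|j].
- rewrite exprS AB; apply/eqP; rewrite eq_complex /=.
  rewrite !(hornerD, hornerN, hornerZ, hornerM, hornerX).
  by apply/andP; split; apply/eqP; ring.
- rewrite coefB poly.coefZ coefXM Aj Bj; case: j => [|j] /=.
    by rewrite !bin0 !subn0 subr0 exprS; ring.
  rewrite doubleS -[RHS]mulrA pascal (exprS _ j).
  by ring.
- by rewrite coefD poly.coefZ Aj Bj -[RHS]mulrA pascal; ring.
Qed.

End Radial.

(** * Coefficients of the transformed monomial and their recurrence *)

Lemma big_ord_double (V : zmodType) (F : nat -> V) K :
  \sum_(l < K.*2) F l = \sum_(j < K) (F j.*2 + F j.*2.+1).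
Proof.
elim: K => [|K IH]; first by rewrite !big_ord0.
by rewrite doubleS !big_ord_recr /= IH addrA.
Qed.

(** The factor [2^q q!] is [(2q)!!], the product of the even numbers up to [2q]. *)
Lemma double_fact_odd q :
  (2 ^ q * q`! * double_fact q.*2.+1 = q.*2.+1`!)%N.
Proof.
elim: q => [//|q IH]; rewrite expnS factS doubleS.
rewrite (_ : double_fact _ = q.*2.+3 * double_fact q.*2.+1)%N //.
rewrite (factS q.*2.+2) (factS q.*2.+1) -IH -muln2; ring.
Qed.

Section FueterCoefficients.
Variables (R : realType) (q k : nat).
Local Notation n := q.*2.+1.

(* The coefficient of [w^(k-l) X^l] in [tau_n [z^(k+2q)]]: the falling factorial
   comes from differentiating [q] times [t^(l./2+q)], and [(-2)^q] collects the
   [2^q] of the chain rule and the sign of [i^(2q)]. *)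
Definition fueter_coef (alpha : R) (l : nat) : R :=
  alpha * (-2) ^+ q * ('C(k + q.*2, l + q.*2) * (l./2 + q) ^_ q)%:R.

(** The ratio of binomials always yields [l + 1 + 2q]. For even [l] this is [beta_(l+1)] and the
    falling factorial is unchanged; for odd [l] the latter grows by [(l + 1 + 2q) / (l + 1)],
    leaving [beta_(l+1) = l + 1]. *)
Lemma fueter_coef_rec alpha l : (l < k)%N ->
  fueter_coef alpha l * (k - l)%:R
    = fueter_coef alpha l.+1 * dirac_coef R n l.+1.
Proof.
move=> lk; rewrite /fueter_coef -!mulrA; congr (_ * (_ * _)).
have bin : (k - l)%:R * 'C(k + q.*2, l + q.*2)%:R
    = (l + q.*2).+1%:R * 'C(k + q.*2, l.+1 + q.*2)%:R :> R.
  by rewrite -!natrM addSn mul_bin_left subnDr.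
have -> : dirac_coef R n l.+1 =
    (if odd l then l.+1 else (l + q.*2).+1)%:R.
  rewrite /dirac_coef /=; case: (odd l); rewrite /= ?mul0r ?addr0 //.
  by rewrite -!natr1 natrD; ring.
rewrite /= uphalf_half !natrM; case: ifP => /= lo.
  have ff : ((l./2 + q) ^_ q)%:R * (l + q.*2).+1%:R
      = ((1 + l./2 + q) ^_ q)%:R * l.+1%:R :> R.
    rewrite -!natrM; congr (_%:R).
    have := ffactnSr (l./2 + q).+1 q; rewrite ffactSS -addSn addnK add1n.
    by have := odd_double_half l; rewrite lo; nia.
  by rewrite -[RHS]mulrA -ff [LHS]mulrC [LHS]mulrA bin; ring.
by rewrite add0n [LHS]mulrC [LHS]mulrA bin; ring.
Qed.

End FueterCoefficients.

(** * The transform of a monomial off the real axis *)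

Section FueterSceMonomial.
Variables (R : realType) (q k : nat).
Local Notation n := q.*2.+1.
Local Notation Cl := (clifford R n).
Local Notation pt := 'rV[R]_n.+1.
Implicit Types (x : pt).

(** The constant [alpha_n] is the one giving [b_0 = 1], by [(2q)! = 2^q q! (2q - 1)!!] and
    [C(k + 2q, 2q) (2q)! k! = (k + 2q)!]. *)
Lemma fueter_coef0 : (0 < q)%N ->
  fueter_coef q k (fueter_sce_const R n (k + n - 1)) 0 = 1.
Proof.
case: q => [//|p] _; rewrite /fueter_coef /fueter_sce_const.
have -> : (k + p.+1.*2.+1 - 1 = k + p.+1.*2)%N by lia.
have -> : ((k + p.+1.*2).+1 - p.+1.*2.+1 = k)%N by lia.
have -> : (p.+1.*2.+1 - 2 = p.*2.+1)%N by lia.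
have -> : p.+1.*2.+1.-1./2 = p.+1 by rewrite /= half_double.
rewrite !add0n ffactnn natrM (exprNn 2).
have bf : 'C(k + p.+1.*2, p.+1.*2)%:R * (p.+1.*2)`!%:R * k`!%:R
    = (k + p.+1.*2)`!%:R :> R.
  by rewrite -!natrM -mulnA -[in RHS](bin_fact (leq_addl k p.+1.*2)) addnK.
have df : 2 ^+ p.+1 * (p.+1)`!%:R * (double_fact p.*2.+1)%:R
    = (p.+1.*2)`!%:R :> R.
  rewrite -natrX -!natrM; congr _%:R.
  rewrite doubleS (factS p.*2.+1) -double_fact_odd expnS (factS p) -muln2.
  ring.
have m0 : (k + p.+1.*2)`!%:R != 0 :> R by rewrite pnatr_eq0 -lt0n fact_gt0.
apply: (mulIf m0); rewrite mul1r -[RHS]bf -df.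
have s2 : (-1) ^+ p.+1 * (-1) ^+ p.+1 = 1 :> R.
  by rewrite -exprMn mulrNN mulr1 expr1n.
transitivity ((-1) ^+ p.+1 * (-1) ^+ p.+1 * ('C(k + p.+1.*2, p.+1.*2)%:R *
   (2 ^+ p.+1 * (p.+1)`!%:R * (double_fact p.*2.+1)%:R) * k`!%:R) : R).
  by field.
by rewrite s2 mul1r.
Qed.

Lemma fueter_sce_off_axis_monomial (alpha : R) x : vec_norm x != 0 ->
  fueter_sce_off_axis alpha (fun z : R[i] => z ^+ (k + q.*2)) x
    = vec_form (fueter_coef q k alpha) k x.
Proof.
move=> r0; rewrite /fueter_sce_off_axis.
have [A [B [AB Aj Bj]]] := complex_exp_horner (x 0 0) (k + q.*2).
have -> : n.-1./2 = q by rewrite /= half_double.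
rewrite (@radial_u_horner _ A) // => [|t _]; last by rewrite AB.
rewrite (@radial_v_horner _ B) // => [|t _]; last by rewrite AB.
(* The factor [r] left by the second radial operator cancels [r^-1] in [X / r]. *)
rewrite sqr_vec_norm mulr_algr !scalerA mulrAC mulfV // mul1r.
set N := vec_sqnorm x; pose K := (k + q.*2).+1.
(* Both polynomials are padded to the common length [K]; the extra coefficients vanish with their
   binomials. *)
have small (p : {poly R}) : (forall j, p`_j = 0 \/ (j <= k + q.*2)%N) ->
    p^`(q).[N] = \sum_(j < K) p^`(q)`_j * N ^+ j.
  move=> pj; rewrite (@horner_coef_wide _ K) //; apply/leq_sizeP => j Kj.
  rewrite coef_derivn; case: (pj (q + j)%N) => [->|]; first by rewrite mul0rn.
  by move: Kj; rewrite /K; lia.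
rewrite (small A) => [|j]; last first.
  have [jm|mj] := leqP j (k + q.*2); [by right|left].
  by rewrite Aj bin_small ?mulr0 ?mul0r //; lia.
rewrite (small B) => [|j]; last first.
  have [jm|mj] := leqP j (k + q.*2); [by right|left].
  by rewrite Bj bin_small ?mulr0 ?mul0r //; lia.
pose F l : Cl := fueter_coef q k alpha l *:
  (x 0 0 ^+ (k - l) *: vec_part x ^+ l).
(* For [l > k] the binomial in [fueter_coef] is 0, so the form may also be padded. *)
have -> : vec_form (fueter_coef q k alpha) k x = \sum_(l < K.*2) F l.
  rewrite /vec_form (big_ord_widen K.*2 F); last by rewrite /K; lia.
  rewrite [RHS](bigID (fun l : 'I_ _ => (l < k.+1)%N)) /=.
  rewrite [X in _ + X]big1 ?addr0 // => l; rewrite -leqNgt => kl.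
  rewrite /F /fueter_coef bin_small ?mul0n ?mulr0 ?scale0r //.
  by rewrite ltn_add2r.
have sN p : (2 ^+ q * (-1) ^+ (q + p) : R) = (-2) ^+ q * (-1) ^+ p.
  by rewrite exprD (exprNn 2) mulrA; congr (_ * _); rewrite mulrC.
(* Even powers of [X] match the real part [A], odd ones the imaginary part [B]; of the sign
   [(-1)^(q+j)], the part [(-1)^j] is absorbed by [(- N)^j]. *)
rewrite big_ord_double scalerDr big_split !scalerA !mulr_sumr !scaler_suml /=.
congr (_ + _); apply: eq_bigr => j _; rewrite /F vec_partX -/N /fueter_coef /=.
  rewrite odd_double half_double !scalerA; congr (_ *: _).
  rewrite coef_derivn Aj doubleD.
  have -> : (k + q.*2 - (q.*2 + j.*2) = k - j.*2)%N by lia.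
  rewrite -[X in _ * (_ * (X * _))]mulr_natr natrM.
  rewrite [(j + q)%N]addnC [(j.*2 + _)%N]addnC (exprNn N).
  rewrite [LHS](_ : _ = alpha * (2 ^+ q * (-1) ^+ (q + j)) *
    'C(k + q.*2, q.*2 + j.*2)%:R * x 0 0 ^+ (k - j.*2) *
     ((q + j) ^_ q)%:R * N ^+ j); last by ring.
  by rewrite sN; ring.
rewrite odd_double uphalf_double !scalerA expr1; congr (_ *: _).
rewrite coef_derivn Bj doubleD -addnS.
have -> : (k + q.*2 - (q.*2 + j.*2.+1) = k - j.*2.+1)%N by lia.
rewrite -[X in _ * (_ * (X * _))]mulr_natr natrM.
rewrite [(j + q)%N]addnC [(j.*2.+1 + _)%N]addnC (exprNn N).
rewrite [LHS](_ : _ = alpha * (2 ^+ q * (-1) ^+ (q + j)) *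
  'C(k + q.*2, q.*2 + j.*2.+1)%:R * x 0 0 ^+ (k - j.*2.+1) *
   ((q + j) ^_ q)%:R * N ^+ j); last by ring.
by rewrite sN; ring.
Qed.

End FueterSceMonomial.

(** * Extension to the real axis by continuity *)

Section OnAxis.
Variables (R : realType) (n : nat).
Local Notation Cl := (clifford R n).
Local Notation pt := 'rV[R]_n.+1.
Implicit Types (x : pt).

Lemma continuous_vec_sqnorm : continuous (@vec_sqnorm R n).
Proof.
apply: continuous_big => [|i _ x]; first exact: add_continuous.
apply: (@continuous_comp _ _ _ (fun y : pt => y 0 (lift ord0 i))
  (fun t => t ^+ 2)); [exact: coord_continuous | exact: exprn_continuous].
Qed.

Lemma continuous_vec_part : continuous (@vec_part R n).
Proof.
apply: continuous_big => [|i _ x]; first exact: add_continuous.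
apply: continuousZr_tmp; exact: coord_continuous.
Qed.

Lemma continuous_vec_form b k : continuous (vec_form b k : pt -> Cl).
Proof.
apply: continuous_big => [|l _ x]; first exact: add_continuous.
apply: (@continuousZl_tmp _ _ _
  (fun y : pt => y 0 0 ^+ (k - l) *: vec_part y ^+ l)).
have -> : (fun y : pt => y 0 0 ^+ (k - l) *: vec_part y ^+ l) =
  fun y => (y 0 0 ^+ (k - l) * (- vec_sqnorm y) ^+ l./2) *: vec_part y ^+ odd l.
  by apply/funext => y; rewrite vec_partX scalerA.
apply: continuousZ.
  apply: continuousM.
    apply: (@continuous_comp _ _ _ (fun y : pt => y 0 0)
      (fun t => t ^+ (k - l))).
      exact: coord_continuous.
    exact: exprn_continuous.
  apply: (@continuous_comp _ _ _ (fun y => - vec_sqnorm y)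
    (fun t => t ^+ l./2)); last exact: exprn_continuous.
  by apply: continuousN; exact: continuous_vec_sqnorm.
by case: (odd l); [exact: continuous_vec_part | exact: cst_continuous].
Qed.

Lemma vec_norm_neq0 x i : x 0 (lift ord0 i) != 0 -> vec_norm x != 0.
Proof.
move=> xi; rewrite -sqrf_eq0 sqr_vec_norm psumr_neq0 => [|j _]; last first.
  exact: sqr_ge0.
apply/hasP; exists i; first exact: mem_index_enum.
by rewrite /= lt0r sqr_ge0 andbT sqrf_eq0.
Qed.

(** A point of the axis is approached along [x + t e_1]. The restricted neighbourhood filter is
    therefore proper, which makes its limits unique. *)
Lemma closure_off_axis x : (0 < n)%N ->
  closure [set y : pt | vec_norm y != 0] x.
Proof.
move=> n0 B Bx; pose i := lift ord0 (Ordinal n0).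
have [xi|xi] := eqVneq (x 0 i) 0; last first.
  by exists x; split; [exact: vec_norm_neq0 xi | exact: nbhs_singleton].
pose line (t : R) : pt := x + t *: delta_mx 0 i.
have line_cont : {for 0, continuous line}.
  apply: continuousD; first exact: cst_continuous.
  by apply: continuousZr_tmp; exact: cvg_id.
have lineB : \forall t \near 0, B (line t).
  by apply: line_cont; rewrite /line scale0r addr0.
near (0 : R)^' => t; exists (line t); split.
  apply: (@vec_norm_neq0 _ (Ordinal n0)).
  rewrite !mxE xi !eqxx mulr1 add0r.
  by near: t; exact: nbhs_dnbhs_neq.
by near: t; exact: nbhs_dnbhs.
Unshelve. all: by end_near. Qed.

Lemma lim_off_axis (f g : pt -> Cl) x : (0 < n)%N -> continuous g ->
  (forall y, vec_norm y != 0 -> f y = g y) ->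
  lim (f y @[y --> within [set y | vec_norm y != 0] (nbhs x)]) = g x.
Proof.
move=> n0 gc fg.
have pF : ProperFilter (within [set y : pt | vec_norm y != 0] (nbhs x)).
  by apply: within_nbhs_proper; exact: closure_off_axis.
apply: cvg_lim; first exact: norm_hausdorff.
apply: (@cvg_trans _ (g y @[y --> within [set y | vec_norm y != 0] (nbhs x)])).
  by apply: near_eq_cvg; rewrite near_withinE; apply: nearW => y yn; rewrite fg.
by apply: cvg_trans (gc x); apply: cvg_app; exact: cvg_within.
Qed.

End OnAxis.

Theorem theorem1 (R : realType) (n : nat) (n_gt1 : (1 < n)%N) (n_odd : odd n)
    (k : nat) (x : 'rV[R]_n.+1) :
  fueter_sce (fueter_sce_const R n (k + n - 1))
    (fun z : R[i] => z ^+ (k + n - 1)) x = appell k x.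
Proof.
have [q nE q_gt0] : exists2 q, n = q.*2.+1 & (0 < q)%N.
  exists n./2; first by rewrite -[LHS]odd_double_half n_odd.
  by case: n n_gt1 {x n_odd} => [|[|]].
subst n; have := fueter_coef0 R k q_gt0.
set alpha := fueter_sce_const _ _ _ => alpha1.
have -> : appell k = vec_form (fueter_coef q k alpha) k
    :> ('rV[R]_q.*2.+2 -> _).
  by apply: appell_vec_form => // l lk; exact: fueter_coef_rec.
have -> : (k + q.*2.+1 - 1 = k + q.*2)%N by lia.
(* On the axis the value is a limit of off-axis values, where the closed form already holds. *)
rewrite /fueter_sce; case: eqVneq => [_|r0].
  apply: lim_off_axis => //; first exact: continuous_vec_form.
  by move=> y y0; exact: fueter_sce_off_axis_monomial.
exact: fueter_sce_off_axis_monomial.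
Qed.
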